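(* Suppose the step size parameters generated by the adaptive stochastic algorithm satisfy the step-size assumption (i)–(ii) stated in the context with constants $\gamma\in(0,1)$, $\bar\alpha>0$, $p\in(\tfrac12,1)$, let $q=1-p$, and suppose the per-iteration oracle cost $\mathsf{oc}(\alpha)\ge 0$ is non-increasing in $\alpha$. Let $c=\frac{2\sqrt{pq}}{(1-2\sqrt{pq})^2}$. For every $\omega>0$ and every positive integer $n$, with probability at least $1-\mathbb P(T_\varepsilon>n)-n^{-\omega}-c\,n^{-(1+\omega)}$, $$\mathsf{TOC}(T_\varepsilon)\le n\cdot\mathsf{oc}(\alpha^*(n)),\qquad \alpha^*(n)=\bar\alpha\,\gamma\,n^{-(1+\omega)\log_{1/(2q)}(1/\gamma)} .$$ Moreover, if $n\ge2$ and $\gamma\ge\max\left\{\frac12,\ \left(\frac1{2q}\right)^{\frac{\log(2\beta)}{(1+\omega)\log n}}\right\}$ for some $0<\beta<\frac12$, then $\alpha^*(n)\ge\beta\bar\alpha$, and thus with probability at least $1-\mathbb P(T_\varepsilon>n)-n^{-\omega}-c\,n^{-(1+\omega)}$, $$\mathsf{TOC}(T_\varepsilon)\le n\cdot \mathsf{oc}(\beta\bar\alpha).$$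
   Context: Algorithmic framework. To minimize $\phi:\mathbb R^m\to\mathbb R$, an adaptive stochastic algorithm with parameters $\gamma\in(0,1)$, $\alpha_{\max}\in(0,\infty)$ and deterministic $x_0$, $\alpha_0\in(0,\alpha_{\max}]$ generates random iterates $X_k$ and random step size parameters $\mathcal A_k>0$, $k\ge 0$, $\mathcal A_0=\alpha_0$. At iteration $k$ stochastic oracles are used to compute a trial point and to decide whether the step is successful. If successful, the trial point is accepted and $\mathcal A_{k+1}=\min\{\gamma^{-1}\mathcal A_k,\alpha_{\max}\}$; otherwise $X_{k+1}=X_k$ and $\mathcal A_{k+1}=\gamma\mathcal A_k$. $(\mathcal F_k)$ denotes the filtration generated by the algorithm up to iteration $k$ ($X_k$ and $\mathcal A_k$ are $\mathcal F_k$-measurable). Stopping time. For $\varepsilon>0$, $T_\varepsilon$ is the first $k$ at which a specified optimality condition holds: $T_\varepsilon=\min\{k:\|\nabla\phi(X_k)\|\le\varepsilon\}$ for non-convex $\phi$, and $T_\varepsilon=\min\{k:\phi(X_k)-\inf\phi\le\varepsilon\}$ for strongly convex $\phi$. It is a stopping time with respect to $(\mathcal F_k)$, possibly infinite. Step-size assumption. (i) For all $k\ge1$, $\mathcal A_k\in\{\gamma\mathcal A_{k-1},\ \min\{\alpha_{\max},\gamma^{-1}\mathcal A_{k-1}\}\}$. (ii) There are constants $\bar\alpha>0$ and $p>\frac12$ such that for all $k$, $\mathbb P(\mathcal A_{k+1}=\gamma^{-1}\mathcal A_k\mid\mathcal F_k)\ge p$ almost surely on the event $\{k<T_\varepsilon,\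 \mathcal A_k\le\bar\alpha\}$. Standing convention: $\alpha_0\ge\bar\alpha$. Oracle cost. $\mathsf{oc}(\alpha)\ge0$ is the cost of the oracle calls in an iteration whose step size parameter is $\alpha$. The total oracle complexity of running the algorithm for $n$ iterations is $\mathsf{TOC}(n)=\sum_{k=1}^{n}\mathsf{oc}(\mathcal A_k)$, and $\mathsf{TOC}(T_\varepsilon)=\sum_{k=1}^{T_\varepsilon}\mathsf{oc}(\mathcal A_k)$. *)

(* Defs.v *)
From HB Require Import structures.
From mathcomp Require Import all_boot all_order all_algebra.
From mathcomp Require Import all_classical all_reals all_analysis.

Set Implicit Arguments.
Unset Strict Implicit.
Unset Printing Implicit Defensive.

Import Order.TTheory GRing.Theory Num.Theory.
Import numFieldNormedType.Exports.

Local Open Scope classical_set_scope.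
Local Open Scope ring_scope.

Definition logb {R : realType} (b x : R) : R := ln x / ln b.

(** The library norm on ['rV[R]_m] is the sup norm; the paper's is Euclidean. *)
Definition l2norm {R : realType} {m : nat} (u : 'rV[R]_m) : R :=
  Num.sqrt (\sum_(i < m) u ord0 i ^+ 2).

Definition grad {R : realType} {m : nat} (phi : 'rV[R]_m -> R) (x : 'rV[R]_m) :
    'rV[R]_m :=
  \row_(i < m) 'D_(delta_mx ord0 i) phi x.

Definition strongly_convex {R : realType} {m : nat} (phi : 'rV[R]_m -> R) :=
  exists2 mu : R, 0 < mu & forall (x y : 'rV[R]_m) (t : R), 0 <= t <= 1 ->
    phi (t *: x + (1 - t) *: y) <=
      t * phi x + (1 - t) * phi y
      - mu / 2 * (t * (1 - t)) * l2norm (x - y) ^+ 2.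

(** [NonConvex] means that no convexity is assumed. *)
Variant objective_class := NonConvex | StronglyConvex.

Definition in_class {R : realType} {m : nat} (cl : objective_class)
    (phi : 'rV[R]_m -> R) : Prop :=
  match cl with
  | NonConvex => forall x, differentiable phi x
  | StronglyConvex => strongly_convex phi
  end.

Definition optimal {R : realType} {m : nat} (cl : objective_class)
    (phi : 'rV[R]_m -> R) (eps : R) (x : 'rV[R]_m) : Prop :=
  match cl with
  | NonConvex => l2norm (grad phi x) <= eps
  | StronglyConvex => phi x - inf (range phi) <= eps
  end.

(** Times in nat + {oo}: [None] is oo. *)
Definition first_time (C : nat -> Prop) : option nat :=
  match pselect (exists k, `[< C k >]) with
  | left ex => Some (ex_minn ex)
  | right _ => None
  end.

Definition lt_time (k : nat) (t : option nat) : bool :=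
  if t is Some j then (k < j)%N else true.

Definition stopping_of {R : realType} {m : nat} {Omega : Type}
    (cl : objective_class) (phi : 'rV[R]_m -> R) (eps : R)
    (X : nat -> Omega -> 'rV[R]_m) (w : Omega) : option nat :=
  first_time (fun k => optimal cl phi eps (X k w)).

Section probability_notions.
Context {d : measure_display} {Omega : measurableType d} {R : realType}.

Definition filtration (F : nat -> set (set Omega)) : Prop :=
  [/\ forall k, sigma_algebra setT (F k),
      forall k, F k `<=` measurable
    & forall k, F k `<=` F k.+1].

Definition measurable_wrt (G : set (set Omega)) (f : Omega -> R) : Prop :=
  forall B : set R, measurable B -> G (f @^-1` B).

Definition stopping_time (F : nat -> set (set Omega)) (T : Omega -> option nat) :
    Prop :=
  forall k, F k [set w | ~~ lt_time k (T w)].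

(** [Z] is a version of P(E | G). *)
Definition is_cond_prob (P : probability Omega R) (G : set (set Omega))
    (E : set Omega) (Z : Omega -> R) : Prop :=
  [/\ measurable_wrt G Z,
      P.-integrable setT (EFin \o Z)
    & forall B, G B -> (\int[P]_(w in B) (Z w)%:E)%E = P (E `&` B)].

(** P(E | G) >= p almost surely on the event D. Versions of P(E | G) exist and
    are a.s. unique, so the choice of version is immaterial. *)
Definition cond_prob_ge_on (P : probability Omega R) (G : set (set Omega))
    (E D : set Omega) (p : R) : Prop :=
  exists2 Z, is_cond_prob P G E Z & {ae P, forall w, D w -> p <= Z w}.

(** [trial k] and [success k] are the trial point and the success event of
    iteration k, as produced by the stochastic oracles. *)
Record adaptive_run (m : nat) (gamma alpha_max alpha0 : R) (x0 : 'rV[R]_m)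
    (F : nat -> set (set Omega))
    (trial : nat -> Omega -> 'rV[R]_m) (success : nat -> set Omega)
    (X : nat -> Omega -> 'rV[R]_m) (A : nat -> Omega -> R) : Prop := {
  run_filtration : filtration F ;
  run_trial : forall k i, measurable_fun setT (fun w => trial k w ord0 i) ;
  run_success : forall k, measurable (success k) ;
  run_X_adapted : forall k i, measurable_wrt (F k) (fun w => X k w ord0 i) ;
  run_A_adapted : forall k, measurable_wrt (F k) (A k) ;
  run_X0 : forall w, X 0 w = x0 ;
  run_A0 : forall w, A 0 w = alpha0 ;
  run_A_gt0 : forall k w, 0 < A k w ;
  run_accept : forall k w, success k w ->
    X k.+1 w = trial k w /\ A k.+1 w = Num.min (gamma^-1 * A k w) alpha_max ;
  run_reject : forall k w, ~ success k w ->
    X k.+1 w = X k w /\ A k.+1 w = gamma * A k w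
}.

Definition step_size_rule (gamma alpha_max : R) (A : nat -> Omega -> R) : Prop :=
  forall k w, A k.+1 w = gamma * A k w \/
              A k.+1 w = Num.min alpha_max (gamma^-1 * A k w).

Definition step_size_drift (P : probability Omega R)
    (F : nat -> set (set Omega)) (gamma alpha_bar p : R)
    (T : Omega -> option nat) (A : nat -> Omega -> R) : Prop :=
  forall k, cond_prob_ge_on P (F k)
    [set w | A k.+1 w = gamma^-1 * A k w]
    [set w | lt_time k (T w) /\ A k w <= alpha_bar] p.

End probability_notions.

Definition TOC {R : realType} {Omega : Type} (oc : R -> R)
    (A : nat -> Omega -> R) (n : nat) (w : Omega) : R :=
  \sum_(1 <= k < n.+1) oc (A k w).

(** The total cost is an infinite series where the run never stops. *)
Definition TOC_at {R : realType} {Omega : Type} (oc : R -> R)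
    (A : nat -> Omega -> R) (T : Omega -> option nat) (w : Omega) : \bar R :=
  match T w with
  | Some t => (TOC oc A t w)%:E
  | None => (\sum_(1 <= k <oo) (oc (A k w))%:E)%E
  end.

Definition alpha_star {R : realType} (gamma alpha_bar q omega : R) (n : nat) : R :=
  alpha_bar * gamma *
    n%:R `^ (- ((1 + omega) * logb (1 / (2 * q)) (1 / gamma))).

(* Main.v *)
(** Let [r = p / q] and [W(x) = max(1, (abar / x)^s)], where [s] is chosen so
    that shrinking the step size by [gamma] multiplies [(abar / x)^s] by [r].
    Since [p r^-1 + q r = 1], the drift condition makes the expectation of
    [W(A_k)] grow by at most [r - 1] per iteration as long as the run has not
    stopped. A step size below [alpha_star] has [W >= r n^(1 + omega)], because
    [r >= 1 / (2 q)], so by Markov's inequality, applied to the process stopped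
    at its first passage below [alpha_star], such a passage occurs within [n]
    iterations with probability at most
    [(1 + n (r - 1)) / (r n^(1 + omega)) <= n^(- omega)]. Off this event and
    [T > n], each of the at most [n] iterations costs at most
    [oc(alpha_star)]. *)
Require Import Defs.
From HB Require Import structures.
From mathcomp Require Import all_boot all_order all_algebra.
From mathcomp Require Import ring lra.
From mathcomp Require Import all_classical all_reals all_analysis measurable_realfun.
Import Order.TTheory GRing.Theory Num.Theory.
Import numFieldNormedType.Exports.
Local Open Scope classical_set_scope.
Local Open Scope ring_scope.

Set Implicit Arguments.
Unset Strict Implicit.
Unset Printing Implicit Defensive.

(** * One-step growth of the barrier *)

Section barrier.
Context {R : realType}.
Implicit Types (s abar gamma x y : R).

(* Up to truncation at [1], the exponential of [s] times the logarithmic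
   distance of [x] below [abar]. *)
Definition barrier s abar x : R := Num.max 1 (expR (s * (ln abar - ln x))).

Lemma barrier_ge1 s abar x : 1 <= barrier s abar x.
Proof. by rewrite le_max lexx. Qed.

Lemma barrier_eq1 s abar x : 0 <= s -> 0 < abar -> abar <= x ->
  barrier s abar x = 1.
Proof.
move=> s0 a0 ax; apply/max_idPl; rewrite -expR0 ler_expR.
rewrite mulr_ge0_le0// subr_le0 ler_ln// posrE//.
exact: lt_le_trans ax.
Qed.

Lemma measurable_barrier s abar :
  measurable_fun [set: R] (barrier s abar : R -> R).
Proof.
apply: measurable_maxr; first exact: measurable_cst.
apply: measurableT_comp; first exact: measurable_expR.
apply: measurable_funM; first exact: measurable_cst.
apply: measurable_funB; first exact: measurable_cst.
exact: measurable_ln.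
Qed.

Section step.
Context (gamma abar amax r : R).
Hypotheses (gamma01 : 0 < gamma < 1) (abar_gt0 : 0 < abar)
  (abar_max : abar <= amax) (r_gt1 : 1 < r).
Let s := ln r / - ln gamma.

Let gamma_gt0 : 0 < gamma. Proof. by case/andP: gamma01. Qed.

Let Nlng_gt0 : 0 < - ln gamma.
Proof. by rewrite oppr_gt0 ln_lt0. Qed.

Let s_ge0 : 0 <= s.
Proof. by rewrite divr_ge0// ltW// ln_gt0. Qed.

Let r_gt0 : 0 < r. Proof. exact: lt_trans r_gt1. Qed.

Let expRs x : 0 < x ->
  expR (s * (ln abar - ln (gamma * x))) = r * expR (s * (ln abar - ln x)).
Proof.
move=> x0; rewrite lnM ?posrE// opprD addrCA mulrDr expRD.
by rewrite /s divfK ?gt_eqF// lnK ?posrE.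
Qed.

Lemma barrier_shrink x : 0 < x ->
  barrier s abar (gamma * x) <= r * barrier s abar x.
Proof.
move=> x0; rewrite {1}/barrier expRs// ge_max; apply/andP; split.
  by rewrite (le_trans (ltW r_gt1))// ler_peMr ?barrier_ge1// ltW.
by rewrite ler_pM2l// le_max lexx orbT.
Qed.

(** Untruncated, the exponential shrinks by exactly [r^-1]. The slack [1 - r^-1] pays for the
    truncation at [1], because the barrier at [x] is at least [1]. *)
Lemma barrier_grow x : 0 < x -> x <= abar ->
  barrier s abar (gamma^-1 * x) <= r^-1 * barrier s abar x + (1 - r^-1).
Proof.
move=> x0 xa; have W1 := barrier_ge1 s abar x.
have V0 : 0 < r^-1 by rewrite invr_gt0.
rewrite {1}/barrier ge_max; apply/andP; split; first by nra.
have gx0 : 0 < gamma^-1 * x by rewrite mulr_gt0// invr_gt0.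
rewrite -(@ler_pM2l _ r)// -expRs// mulVKf ?gt_eqF//.
rewrite (@le_trans _ _ (barrier s abar x))//; first by rewrite le_max lexx orbT.
rewrite mulrDr mulVKf ?gt_eqF// lerDl mulr_ge0 ?(ltW r_gt0)//.
by rewrite subr_ge0 invf_le1// ltW.
Qed.

(** All randomness is confined to one indicator term, supported where the step size fails to grow by
    [gamma^-1]; the drift condition bounds the conditional probability of exactly this event. *)
Lemma barrier_step_le x y : 0 < x -> x <= abar ->
    y = gamma * x \/ y = Num.min amax (gamma^-1 * x) ->
  barrier s abar y <= r^-1 * barrier s abar x
    + (if y == gamma^-1 * x then 0 else (r - r^-1) * barrier s abar x)
    + (1 - r^-1).
Proof.
move=> x0 xa yE; have W1 := barrier_ge1 s abar x.
have V0 : 0 < r^-1 by rewrite invr_gt0.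
have V1 : r^-1 < 1 by rewrite invf_lt1.
have := barrier_grow x0 xa; have := barrier_shrink x0.
case: eqP => [->|yN]; first lra.
case: yE => [-> | yE]; first by nra.
(* The remaining case has the cap active: [y = amax >= abar], so the barrier takes its least
   value. *)
suff -> : barrier s abar y = 1.
  rewrite -mulrDl addrC [r^-1 + _]addrC subrK.
  have := ler_pM ler01 ler01 (ltW r_gt1) W1; lra.
apply: barrier_eq1 => //; move: yN; rewrite yE minElt.
by case: ifPn => // _; rewrite eqxx.
Qed.

(** The drift condition says nothing above [abar], but there the barrier is [1], and even a
    shrinking step lifts it to at most [r]. *)
Lemma barrier_step_gt x y : abar < x ->
    y = gamma * x \/ y = Num.min amax (gamma^-1 * x) ->
  barrier s abar y <= barrier s abar x + (r - 1).
Proof.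
move=> ax yE; have x0 : 0 < x := lt_trans abar_gt0 ax.
have W1 : barrier s abar x = 1 by apply: barrier_eq1 => //; exact: ltW.
case: yE => ->.
  by have := barrier_shrink x0; rewrite W1; lra.
suff -> : barrier s abar (Num.min amax (gamma^-1 * x)) = 1.
  by rewrite W1 lerDl subr_ge0 ltW.
apply: barrier_eq1 => //; rewrite le_min abar_max (le_trans (ltW ax))//.
by rewrite ler_peMl ?(ltW x0)// invf_ge1//; case/andP: gamma01 => _ /ltW.
Qed.

End step.

End barrier.

(** * Integrating a conditional probability bound *)

Section conditional_probability.
Context {d : measure_display} {Omega : measurableType d} {R : realType}.
Variable P : probability Omega R.
Implicit Types (G : set (set Omega)) (E D B : set Omega) (A : Omega -> R) (p : R).

Lemma sigma_algebra_setC G B : sigma_algebra setT G -> G B -> G (~` B).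
Proof. by case=> _ GC _ /GC; rewrite setTD. Qed.

Lemma sigma_algebra_setI G B E : sigma_algebra setT G -> G B -> G E ->
  G (B `&` E).
Proof. by case/(sigma_algebraP (fun _ _ => @subsetT _ _)) => _ _ _; apply. Qed.

Lemma measurable_wrtP G A : G `<=` measurable -> measurable_wrt G A ->
  measurable_fun setT A.
Proof. by move=> Gm mA _ B mB; rewrite setTI; exact/Gm/mA. Qed.

Lemma cond_prob_ge_le G E D B p : G `<=` measurable -> 0 <= p ->
    cond_prob_ge_on P G E D p -> G B -> B `<=` D ->
  (p%:E * P B <= P (E `&` B))%E.
Proof.
move=> Gm p0 [Z [mZ _ ZE] pZ] GB BD; rewrite -ZE//.
have mB := Gm _ GB.
have mZB : measurable_fun B Z.
  by apply: measurable_funTS; exact: measurable_wrtP mZ.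
(* The lower bound on [Z] holds only almost everywhere. Its maximum with [p] has the same integral
   over [B] and is at least [p] at every point. *)
rewrite (ae_eq_integral (fun w => (Num.max (Z w) p)%:E)) //; last 3 first.
- exact/measurable_EFinP.
- by apply/measurable_EFinP; apply: measurable_maxr => //; exact: measurable_cst.
- by move: pZ; apply: filterS => w pZ /BD/pZ /max_idPl ->.
rewrite -integral_cst//; apply: ge0_le_integral => //.
- by apply/measurable_EFinP; apply: measurable_maxr => //; exact: measurable_cst.
- by move=> w _; rewrite lee_fin le_max lexx orbT.
Qed.

Lemma cond_prob_ge_setD G E D B p :
    G `<=` measurable -> 0 <= p -> measurable E ->
    cond_prob_ge_on P G E D p -> G B -> B `<=` D ->
  (P (B `\` E) <= (1 - p)%:E * P B)%E.
Proof.
move=> Gm p0 mE pE GB BD; have mB := Gm _ GB.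
have := cond_prob_ge_le Gm p0 pE GB BD.
have -> : P (B `\` E) = (P B - P (B `&` E))%E.
  by apply: measureD => //; rewrite ltey_eq fin_num_measure.
rewrite setIC.
have mBE : measurable (B `&` E) by exact: measurableI.
rewrite -(fineK (fin_num_measure P _ mB)) -(fineK (fin_num_measure P _ mBE)).
rewrite -EFinM -EFinB -EFinM !lee_fin; lra.
Qed.

Lemma ge0_integral_setID D B (f : Omega -> \bar R) : measurable D ->
    measurable B -> (forall w, D w -> 0 <= f w)%E -> measurable_fun D f ->
  (\int[P]_(w in D) f w =
   \int[P]_(w in D `&` B) f w + \int[P]_(w in D `\` B) f w)%E.
Proof.
move=> mD mB f0 mf; rewrite -{1}(setUIDK D B) ge0_integral_setU ?setUIDK//.
- exact: measurableI.
- exact: measurableD.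
- by apply/disj_setPS => w [[_ ?] [_ ?]].
Qed.

(** An integral over a subset becomes one over the whole space, so that the measure can be pushed
    forward. The restricted measure is null off [D] and agrees with [P] inside it. *)
Lemma ge0_integral_mrestr D (mD : measurable D) (f : Omega -> \bar R) :
    (forall w, 0 <= f w)%E -> measurable_fun setT f ->
  (\int[mrestr P mD]_w f w = \int[P]_(w in D) f w)%E.
Proof.
move=> f0 mf; rewrite -(setUv D) ge0_integral_setU//; last 3 first.
- exact: measurableC.
- by rewrite setUv.
- exact/disj_setPCl.
rewrite [X in (_ + X)%E]null_set_integral ?adde0//; last 3 first.
- exact: measurableC.
- exact: measurable_funTS.
- by rewrite -[LHS]/(P (~` D `&` D)) setICl measure0.
apply: eq_measure_integral => B mB BD.
by rewrite /= /mrestr setIidl.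
Qed.

(* Both sides integrate [f] against images under [A] of measures that
   [cond_prob_ge_setD] compares on the sigma-algebra [G]. *)
Lemma integral_setD_cond_prob_ge G E D D' p A (f : R -> R) :
    sigma_algebra setT G -> G `<=` measurable -> 0 <= p <= 1 -> measurable E ->
    cond_prob_ge_on P G E D p -> G D' -> D' `<=` D -> measurable_wrt G A ->
    (forall x, 0 <= f x) -> measurable_fun setT f ->
  (\int[P]_(w in D' `\` E) (f (A w))%:E <=
   (1 - p)%:E * \int[P]_(w in D') (f (A w))%:E)%E.
Proof.
move=> Gs Gm /andP[p0 p1] mE pE GD DD mA f0 mf.
have mD := Gm _ GD.
have mDE : measurable (D' `\` E) by exact: measurableD.
have mAT := measurable_wrtP Gm mA.
have q0 : 0 <= 1 - p by rewrite subr_ge0.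
have mfE : measurable_fun setT (EFin \o f) by exact/measurable_EFinP.
have mfA : measurable_fun setT (fun w => (f (A w))%:E).
  by apply/measurable_EFinP; exact: measurableT_comp.
rewrite -(ge0_integral_mrestr mDE)//; last by move=> w; rewrite lee_fin.
rewrite -(ge0_integral_mrestr mD)//; last by move=> w; rewrite lee_fin.
have pf (mu : {measure set Omega -> \bar R}) :
    (\int[mu]_w (f (A w))%:E = \int[pushforward mu A]_y (EFin \o f) y)%E.
  rewrite [RHS]ge0_integral_pushforward//.
  by move=> y _; rewrite /= lee_fin.
rewrite !pf -(@ge0_integral_mscale _ _ _ _ _ measurableT (NngNum q0))//; last first.
  by move=> y _; rewrite /= lee_fin.
apply: ge0_le_measure_integral => //.
(* On a Borel set [S] the comparison is the conditional bound on the part of [D'] where [A] lies in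
   [S], a set of [G] since [A] is [G]-measurable. *)
move=> S mS; rewrite /= /mscale /= /pushforward /mrestr setDE setIA -setDE.
apply: cond_prob_ge_setD pE _ _ => //.
- by apply: sigma_algebra_setI => //; exact: mA.
- by move=> w [_ /DD].
Qed.

End conditional_probability.

(** * Probability of a passage below the level [b] *)

Section hitting_bound.
Context {d : measure_display} {Omega : measurableType d} {R : realType}.
Variables (P : probability Omega R) (F : nat -> set (set Omega)).
Variables (T : Omega -> option nat) (A : nat -> Omega -> R).
Variables (gamma amax abar p b : R).
Hypotheses (filtF : filtration F) (adA : forall k, measurable_wrt (F k) (A k)).
Hypotheses (A_gt0 : forall k w, 0 < A k w) (stopT : stopping_time F T).
Hypotheses (ruleA : step_size_rule gamma amax A).
Hypotheses (driftA : step_size_drift P F gamma abar p T A).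
Hypotheses (gamma01 : 0 < gamma < 1) (p12 : 1 / 2 < p < 1).
Hypotheses (abar_gt0 : 0 < abar) (abar_max : abar <= amax).
Hypotheses (abar_A0 : forall w, abar <= A 0 w).

(** Stopping the process is encoded by integrating over these events, which decrease in [k] and
    belong to [F k]. *)
Definition running k : set Omega :=
  [set w | lt_time k (T w) /\ forall j, (j <= k)%N -> b <= A j w].

(** The passage happens at time [k.+1], which may equal the stopping time, whose iteration is still
    charged in the cost. *)
Definition first_below k : set Omega := running k `\` [set w | b <= A k.+1 w].

Let r := p / (1 - p).
Let W : R -> R := barrier (ln r / - ln gamma) abar.

Let p_gt0 : 0 < p. Proof. by case/andP: p12 => /(lt_trans _)->. Qed.

Let q_gt0 : 0 < 1 - p. Proof. by rewrite subr_gt0; case/andP: p12. Qed.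

Let r_gt1 : 1 < r. Proof. by rewrite ltr_pdivlMr// mul1r; case/andP: p12; lra. Qed.

Let r_gt0 : 0 < r. Proof. exact: lt_trans r_gt1. Qed.

Let sF k : sigma_algebra setT (F k). Proof. by case: filtF. Qed.

Let Fm k : F k `<=` measurable. Proof. by case: filtF => _ + _; apply. Qed.

Lemma measurable_adapted k : measurable_fun setT (A k).
Proof. exact: (@measurable_wrtP _ _ _ (F k)). Qed.

Lemma filtration_running k : F k (running k).
Proof.
apply: (@sigma_algebra_setI _ _ _ [set w | lt_time k (T w)]
    [set w | forall j, (j <= k)%N -> b <= A j w]) => //.
  rewrite (_ : [set _ | _] = ~` [set w | ~~ lt_time k (T w)]).
    by apply: sigma_algebra_setC; [exact: sF|exact: stopT].
  by apply/seteqP; split => w /= => [->//|/negP]; rewrite negbK.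
have Fb i : F i [set w | b <= A i w].
  rewrite (_ : [set _ | _] = A i @^-1` `[b, +oo[); first exact: adA.
  by apply/seteqP; split => w /=; rewrite in_itv/= andbT.
elim: k => [|k IH].
  rewrite (_ : [set _ | _] = [set w | b <= A 0 w]); first exact: Fb.
  apply/seteqP; split => w /=; first by move/(_ 0%N); exact.
  by move=> bA j; rewrite leqn0 => /eqP ->.
rewrite (_ : [set _ | _] = [set w | forall j, (j <= k)%N -> b <= A j w] `&`
    [set w | b <= A k.+1 w]).
  apply: sigma_algebra_setI => //.
  by case: filtF => _ _ /(_ k); exact.
apply/seteqP; split => w /= => [bA|[bA bA1] j].
  by split=> [j jk|]; apply: bA => //; exact: leqW.
by rewrite leq_eqVlt => /predU1P[->//|]; exact: bA.
Qed.

Lemma measurable_running k : measurable (running k).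
Proof. exact/Fm/filtration_running. Qed.

Lemma measurable_first_below k : measurable (first_below k).
Proof.
apply: measurableD; first exact: measurable_running.
rewrite -[X in measurable X]setTI.
by apply: measurable_fun_le => //; exact: measurable_adapted.
Qed.

Let mW k D : measurable_fun D (fun w => (W (A k w))%:E).
Proof.
apply: measurable_funTS; apply/measurable_EFinP.
apply: measurableT_comp; first exact: measurable_barrier.
exact: measurable_adapted.
Qed.

Let W_ge0 x : 0 <= W x.
Proof. by rewrite (le_trans ler01)// barrier_ge1. Qed.

(** The event is split at [A k = abar]: below, the pointwise bound is averaged with the drift
    condition; above, the increment is bounded surely. *)
Lemma integral_barrier_step k :
  (\int[P]_(w in running k) (W (A k.+1 w))%:E <=
   \int[P]_(w in running k) (W (A k w))%:E + (r - 1)%:E)%E.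
Proof.
have mrun := measurable_running k.
have V1 : r^-1 < 1 by rewrite invf_lt1.
have Vr : r^-1 < r := lt_trans V1 r_gt1.
(* The constant term from the lower part is at most the increment [r - 1] of the upper part. *)
have V2 : 1 - r^-1 <= r - 1.
  rewrite -subr_ge0 (_ : _ - _ = (r - 1) * (1 - r^-1)).
    by rewrite mulr_ge0// subr_ge0 ltW.
  by field; rewrite gt_eqF.
pose L := [set w | A k w <= abar].
pose E := [set w | A k.+1 w = gamma^-1 * A k w].
have FL : F k L.
  rewrite (_ : L = A k @^-1` `]-oo, abar]); first exact: adA.
  by apply/seteqP; split => w /=; rewrite in_itv.
have mL := Fm FL.
have mE : measurable E.
  rewrite (_ : E = (setT `&` [set w | A k.+1 w <= gamma^-1 * A k w]) `&`
                   (setT `&` [set w | gamma^-1 * A k w <= A k.+1 w])).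
    have mA := measurable_adapted.
    by apply: measurableI; apply: measurable_fun_le => //; exact: measurable_funM.
  rewrite !setTI; apply/seteqP; split => w /= => [->//|[le1 le2]].
  by apply/eqP; rewrite eq_le le1.
have FrunL : F k (running k `&` L).
  by apply: sigma_algebra_setI => //; exact: filtration_running.
have mrunL := Fm FrunL.
have mrunH : measurable (running k `\` L) by exact: measurableD.
rewrite !(@ge0_integral_setID _ _ _ _ (running k) L)//;
  try by move=> w _; rewrite lee_fin.
(* The two parts together contribute at most one copy of [r - 1]. *)
have PE : (P (running k `&` L) + P (running k `\` L) <= 1)%E.
  rewrite -measureU//; first exact: probability_le1 (measurableU _ _ _ _).
  by apply/seteqP; split => // w [[_ ?] [_ ?]].
have low : (\int[P]_(w in running k `&` L) (W (A k.+1 w))%:E <=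
   \int[P]_(w in running k `&` L) (W (A k w))%:E
     + (r - 1)%:E * P (running k `&` L))%E.
  have mWE : measurable_fun (running k `&` L)
      ((fun w => (W (A k w))%:E) \_ (~` E)).
    apply: measurable_funTS.
    by apply: (measurable_restrictT _ (measurableC mE)).1.
  have WE0 w : (0 <= ((fun w => (W (A k w))%:E) \_ (~` E)) w)%E.
    by rewrite patchE; case: ifPn; rewrite ?lee_fin.
  apply: (@le_trans _ _ (\int[P]_(w in running k `&` L)
      ((r^-1)%:E * (W (A k w))%:E
       + (r - r^-1)%:E * ((fun w => (W (A k w))%:E) \_ (~` E)) w
       + (1 - r^-1)%:E))%E).
    apply: ge0_le_integral => //.
    - by move=> w _; rewrite lee_fin.
    - apply: emeasurable_funD => //.
      by apply: emeasurable_funD; exact: emeasurable_funM.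
    - move=> w [_ Lw].
      have := barrier_step_le gamma01 abar_gt0 abar_max r_gt1 (A_gt0 k w) Lw
        (ruleA k w).
      rewrite patchE; case: eqP => [Ew|Ew].
        by rewrite memNset ?mule0; [rewrite lee_fin|exact].
      by rewrite mem_set// lee_fin.
  rewrite ge0_integralD//; first last.
  - by move=> w _; rewrite lee_fin subr_ge0 ltW.
  - by apply: emeasurable_funD; exact: emeasurable_funM.
  - move=> w _; rewrite adde_ge0 ?mule_ge0// lee_fin//.
      by rewrite invr_ge0 ltW.
    by rewrite subr_ge0 ltW.
  rewrite integral_cst// ge0_integralD//; first last.
  - exact: emeasurable_funM.
  - by move=> w _; rewrite mule_ge0// lee_fin subr_ge0 ltW.
  - exact: emeasurable_funM.
  - by move=> w _; rewrite mule_ge0 ?lee_fin// invr_ge0 ltW.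
  rewrite !ge0_integralZl_EFin//; first last.
  - by rewrite invr_ge0 ltW.
  - by move=> w _; rewrite lee_fin.
  - by rewrite subr_ge0 ltW.
  rewrite -integral_mkcondr -setDE.
  set I := (\int[P]_(w in _ `&` _) _)%E.
  have J : (\int[P]_(w in running k `&` L `\` E) (W (A k w))%:E <=
      (1 - p)%:E * I)%E.
    apply: integral_setD_cond_prob_ge (driftA k) _ _ _ _ _ => //.
    - by apply/andP; split; apply: ltW => //; rewrite -subr_gt0.
    - by move=> w [[Tw _] Lw].
    - exact: measurable_barrier.
  have I0 : (0 <= I)%E by apply: integral_ge0 => w _; rewrite lee_fin.
  apply: leeD; last by rewrite lee_wpmul2r// lee_fin.
  rewrite (@le_trans _ _ ((r^-1)%:E * I +
      (r - r^-1)%:E * ((1 - p)%:E * I))%E)//.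
    by rewrite leeD2l// lee_wpmul2l// lee_fin subr_ge0 ltW.
  rewrite muleA -EFinM -ge0_muleDl//; first last.
  - by rewrite lee_fin mulr_ge0// ?subr_ge0 ltW// -subr_gt0.
  - by rewrite lee_fin invr_ge0 ltW.
  (* This is the balance [p r^-1 + (1 - p) r = 1], which fixes the choice of [r]. *)
  rewrite -EFinD (_ : r^-1 + (r - r^-1) * (1 - p) = 1) ?mul1e// /r.
  by field; rewrite !gt_eqF.
have high : (\int[P]_(w in running k `\` L) (W (A k.+1 w))%:E <=
   \int[P]_(w in running k `\` L) (W (A k w))%:E
     + (r - 1)%:E * P (running k `\` L))%E.
  rewrite -integral_cst// -ge0_integralD//; first last.
  - by move=> w _; rewrite lee_fin subr_ge0 ltW.
  - by move=> w _; rewrite lee_fin.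
  apply: ge0_le_integral => //.
  - by move=> w _; rewrite lee_fin.
  - exact: emeasurable_funD.
  move=> w [_ /negP]; rewrite -ltNge => Aw.
  rewrite lee_fin; apply: barrier_step_gt (ruleA k w) => //.
apply: le_trans (leeD low high) _.
rewrite addeACA leeD2l//.
by rewrite -ge0_muleDr// -[leRHS]mule1 lee_pmul2l// ?lte_fin subr_gt0.
Qed.

(** Each iteration adds at most [r - 1]. Mass leaving through a passage below [b] carries barrier at
    least [a] and moves into the sum; mass leaving because the run stops is discarded. *)
Lemma integral_barrier_le n (a : R) : 0 <= a -> (forall w, b <= A 0 w) ->
    (forall x : R, 0 < x -> x < b -> a <= W x) ->
  (\int[P]_(w in running n) (W (A n w))%:E
     + a%:E * \sum_(i < n) P (first_below i) <= (1 + n%:R * (r - 1))%:E)%E.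
Proof.
move=> a0 bA0 aW; elim: n => [|n IH].
  rewrite big_ord0 mule0 adde0 mul0r addr0.
  (* The initial step size is at least [abar], where the barrier is [1]. *)
  rewrite (eq_integral (cst 1%E)).
    rewrite integral_cst ?mul1e; last exact: measurable_running.
    exact/probability_le1/measurable_running.
  move=> w _; rewrite /W barrier_eq1//.
  by rewrite divr_ge0// ?ln_ge0 ?(ltW r_gt1)// oppr_ge0 ln_le0// ltW//;
    case/andP: gamma01.
rewrite big_ord_recr/= ge0_muleDr//; last exact: sume_ge0.
have mrun := measurable_running n.
have mbelow := measurable_first_below n.
have mB : measurable [set w | b <= A n.+1 w].
  by rewrite -[X in measurable X]setTI;
     apply: measurable_fun_le => //; exact: measurable_adapted.
have above : (\int[P]_(w in running n.+1) (W (A n.+1 w))%:E <=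
    \int[P]_(w in running n `&` [set w | (b <= A n.+1 w)%R]) (W (A n.+1 w))%:E)%E.
  apply: ge0_subset_integral => //.
  - exact: measurable_running.
  - exact: measurableI.
  - by move=> w _; rewrite lee_fin.
  move=> w [Tw bA]; split; last exact: bA.
  split=> [|j jn]; last by apply: bA; exact: leqW.
  by move: Tw; rewrite /lt_time; case: (T w) => // t; exact: ltnW.
have below : (a%:E * P (first_below n) <=
    \int[P]_(w in first_below n) (W (A n.+1 w))%:E)%E.
  rewrite -integral_cst//; apply: ge0_le_integral => //.
  - by move=> w [_ /negP]; rewrite -ltNge lee_fin => wb; exact: aW.
have step := integral_barrier_step n.
have runE : (\int[P]_(w in running n) (W (A n.+1 w))%:E =
   \int[P]_(w in running n `&` [set w | (b <= A n.+1 w)%R]) (W (A n.+1 w))%:E +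
   \int[P]_(w in first_below n) (W (A n.+1 w))%:E)%E.
  by apply: ge0_integral_setID => // w _; rewrite lee_fin.
rewrite addeCA addeC; apply: (@le_trans _ _
  ((\int[P]_(w in running n) (W (A n w))%:E + (r - 1)%:E)
     + a%:E * \sum_(i < n) P (first_below i))%E).
  by rewrite leeD2r// (le_trans _ step)// runE leeD.
rewrite addeAC -natr1 mulrDl mul1r addrA [leRHS]EFinD.
exact: leeD2r.
Qed.

(** This is the Markov step: the nonnegative integral over the surviving runs is dropped. *)
Lemma measure_first_below_le n (a : R) : 0 < a -> (forall w, b <= A 0 w) ->
    (forall x : R, 0 < x -> x < b -> a <= W x) ->
  (P (\big[setU/set0]_(i < n) first_below i) <=
   ((1 + n%:R * (r - 1)) / a)%:E)%E.
Proof.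
move=> a0 bA0 aW; apply: le_trans (Boole_inequality P _) _.
  by move=> i _; exact: measurable_first_below.
rewrite mulrC EFinM lee_pdivlMl//.
apply: le_trans (integral_barrier_le n (ltW a0) bA0 aW).
by rewrite leeDr// integral_ge0// => w _; rewrite lee_fin.
Qed.

(** A first index [k.+1 <= t] with step size below [b] would put [w] in [first_below k], and
    [k < t <= n] makes this a member of the union. *)
Lemma above_of_not_first_below n t w : (forall w, b <= A 0 w) ->
    T w = Some t -> (t <= n)%N -> ~ (\big[setU/set0]_(i < n) first_below i) w ->
  forall j, (j <= t)%N -> b <= A j w.
Proof.
move=> bA0 Tw tn nbad.
suff H k : (k <= t)%N -> forall j, (j <= k)%N -> b <= A j w by exact: H.
elim: k => [_ j|k IH kt j]; first by rewrite leqn0 => /eqP ->.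
rewrite leq_eqVlt => /predU1P[->|]; last exact/IH/ltnW.
apply/negPn/negP => bA; apply: nbad.
have kn : (k < n)%N := leq_trans kt tn.
rewrite (bigD1 (Ordinal kn))//=; left; split; last exact/negP.
by split; [rewrite Tw|exact/IH/ltnW].
Qed.

End hitting_bound.

(** * Measurability and bounds of the total cost *)

Section total_cost.
Context {d : measure_display} {Omega : measurableType d} {R : realType}.
Variables (F : nat -> set (set Omega)) (T : Omega -> option nat).
Variables (A : nat -> Omega -> R) (oc : R -> R).
Hypotheses (filtF : filtration F) (adA : forall k, measurable_wrt (F k) (A k)).
Hypotheses (A_gt0 : forall k w, 0 < A k w) (stopT : stopping_time F T).
Hypotheses (oc_ge0 : forall a : R, 0 < a -> 0 <= oc a).
Hypotheses (oc_ni : forall a b : R, 0 < a -> a <= b -> oc b <= oc a).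

Lemma measurable_lt_time k : measurable [set w | lt_time k (T w)].
Proof.
rewrite (_ : [set _ | _] = ~` [set w | ~~ lt_time k (T w)]).
  by apply: measurableC; case: filtF => _ Fm _; exact/Fm/stopT.
by apply/seteqP; split => w /= => [->//|/negP]; rewrite negbK.
Qed.

Lemma measurable_oc k : measurable_fun setT (fun w => oc (A k w)).
Proof.
have mA : measurable_fun setT (A k).
  by case: filtF => _ /(_ k) Fm _; exact: measurable_wrtP Fm (adA k).
apply: (measurability (@RGenCInfty.G R)) => [|/= _ [_] [r] -> <-].
  exact: RGenCInfty.measurableE.
(* [oc] is monotone on positive arguments only. There its superlevel sets are intervals, hence
   Borel, and [A k] takes only positive values. *)
pose I := [set a : R | 0 < a /\ r <= oc a].
rewrite (_ : _ `&` _ = setT `&` A k @^-1` I).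
  apply: mA => //; apply: is_interval_measurable => x y /= [x0 rx] [y0 ry] z.
  move=> /andP[xz zy]; split; first exact: lt_le_trans xz.
  by rewrite (le_trans ry)// oc_ni// (lt_le_trans x0).
rewrite !setTI; apply/seteqP; split => w /=; rewrite in_itv/= andbT.
  by move=> ?; split.
by case.
Qed.

Lemma TOC_nondecreasing w m n : (m <= n)%N -> TOC oc A m w <= TOC oc A n w.
Proof.
move=> mn; rewrite /TOC (@big_cat_nat _ _ _ m.+1 1 n.+1)//= lerDl.
by apply: sumr_ge0 => k _; exact: oc_ge0.
Qed.

(** Finite and infinite stopping times are treated alike, and the cost event becomes a countable
    intersection of measurable conditions. *)
Lemma TOC_at_leP w y : 0 <= y ->
  (TOC_at oc A T w <= y%:E)%E <->
  (forall k, lt_time k (T w) -> TOC oc A k.+1 w <= y).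
Proof.
move=> y0; rewrite /TOC_at; case: (T w) => [t|] /=.
  rewrite lee_fin; split => [ty k kt|H].
    exact: le_trans (TOC_nondecreasing w kt) ty.
  (* A run stopped at time [0] has an empty cost sum, bounded because [0 <= y]. *)
  by case: t H => [_|t]; [rewrite /TOC big_geq|exact].
have e0 n : (1 <= n)%N -> true -> (0 <= (oc (A n w))%:E)%E.
  by move=> _ _; rewrite lee_fin oc_ge0.
split => [sy k _|H].
  rewrite -lee_fin (le_trans _ sy)// /TOC -sumEFin.
  exact: nneseries_lim_ge.
apply: lime_le; first exact: is_cvg_nneseries.
near=> k; rewrite sumEFin lee_fin.
have /prednK <- : (0 < k)%N by near: k; exact: nbhs_infty_gt.
by case: k.-1 => [|j]; [rewrite big_geq|exact: H].
Unshelve. all: by end_near. Qed.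

Lemma measurable_TOC_at_le y : 0 <= y ->
  measurable [set w | (TOC_at oc A T w <= y%:E)%E].
Proof.
move=> y0; rewrite (_ : [set _ | _] = \bigcap_k
    (~` [set w | lt_time k (T w)] `|`
     (setT `&` [set w | TOC oc A k.+1 w <= y]))).
  apply: bigcap_measurableType => k _; apply: measurableU.
    exact/measurableC/measurable_lt_time.
  apply: measurable_fun_le => //.
  by apply: measurable_sum => i; exact: measurable_oc.
apply/seteqP; split => w /=.
  move=> /(TOC_at_leP w y0) H k _ /=.
  by case: (boolP (lt_time k (T w))) => [/H|/negP]; [right|left].
by move=> H; apply/(TOC_at_leP w y0) => k kT; case: (H k I) => // -[].
Qed.

Lemma TOC_at_le w t n b y : T w = Some t -> (t <= n)%N -> 0 < b ->
    (forall j, (j <= t)%N -> b <= A j w) -> oc b <= y ->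
  (TOC_at oc A T w <= (n%:R * y)%:E)%E.
Proof.
move=> Tw tn b0 bA ocy; rewrite /TOC_at Tw lee_fin /TOC.
have y0 : 0 <= y := le_trans (oc_ge0 b0) ocy.
apply: (@le_trans _ _ (t%:R * y)); last by rewrite ler_wpM2r// ler_nat.
rewrite [leRHS](_ : _ = \sum_(1 <= k < t.+1) y).
  apply: ler_sum_nat => k /andP[_ kt]; rewrite (le_trans _ ocy)//.
  exact/oc_ni/bA.
by rewrite sumr_const_nat subSS subn0 mulr_natl.
Qed.

End total_cost.

(** * Estimates for the threshold [alpha_star] *)

Section alpha_star.
Context {R : realType}.
Variables (gamma abar p omega : R) (n : nat).
Hypotheses (gamma01 : 0 < gamma < 1) (abar_gt0 : 0 < abar).
Hypotheses (p12 : 1 / 2 < p < 1) (omega_gt0 : 0 < omega) (n_gt0 : (0 < n)%N).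
Let q := 1 - p.
Let astar := alpha_star gamma abar q omega n.

Let gamma_gt0 : 0 < gamma. Proof. by case/andP: gamma01. Qed.

Let q_gt0 : 0 < q. Proof. by rewrite subr_gt0; case/andP: p12. Qed.

Let q2_gt0 : 0 < 1 / (2 * q). Proof. by rewrite divr_gt0// mulr_gt0. Qed.

Let ln2q_gt0 : 0 < ln (1 / (2 * q)).
Proof.
by rewrite ln_gt0// ltr_pdivlMr ?mulr_gt0// mul1r /q; case/andP: p12; lra.
Qed.

Let nR_gt0 : 0 < n%:R :> R. Proof. by rewrite ltr0n. Qed.

Let lnn_ge0 : 0 <= ln n%:R :> R. Proof. by rewrite ln_ge0// ler1n. Qed.

Let Nlng_gt0 : 0 < - ln gamma. Proof. by rewrite oppr_gt0 ln_lt0. Qed.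

Lemma alpha_star_gt0 : 0 < astar.
Proof. by rewrite !mulr_gt0// powR_gt0. Qed.

Lemma ln_alpha_star : ln astar =
  ln abar + ln gamma
    - (1 + omega) * (- ln gamma / ln (1 / (2 * q))) * ln n%:R.
Proof.
rewrite /astar /alpha_star /logb.
rewrite lnM ?posrE ?mulr_gt0 ?powR_gt0// ln_powR lnM ?posrE//.
by rewrite mulNr div1r lnV// posrE.
Qed.

Lemma alpha_star_le : astar <= abar.
Proof.
rewrite -ler_ln ?posrE ?alpha_star_gt0// ln_alpha_star.
have : 0 <= (1 + omega) * (- ln gamma / ln (1 / (2 * q))) * ln n%:R.
  rewrite mulr_ge0// mulr_ge0 ?divr_ge0 ?(ltW ln2q_gt0) ?(ltW Nlng_gt0)//.
  by rewrite addr_ge0// ltW.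
move: Nlng_gt0; lra.
Qed.

(** The factor [gamma] of [alpha_star] yields [p / q]. The power of [n] yields [n^(1 + omega)]
    raised to [ln (p / q) / ln (1 / (2 q))], an exponent at least [1] because [p >= 1 / 2]. *)
Lemma barrier_alpha_star x : 0 < x -> x < astar ->
  p / q * n%:R `^ (1 + omega) <= barrier (ln (p / q) / - ln gamma) abar x.
Proof.
move=> x0 xa; have r2q : 1 / (2 * q) <= p / q.
  rewrite invfM mul1r ler_pM2r ?invr_gt0//.
  by case/andP: p12; lra.
have r0 : 0 < p / q by rewrite (lt_le_trans q2_gt0).
rewrite le_max; apply/orP; right.
have -> : p / q * n%:R `^ (1 + omega) =
    expR (ln (p / q) + (1 + omega) * ln n%:R).
  by rewrite -ln_powR expRD !lnK ?posrE ?powR_gt0.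
rewrite ler_expR.
have lr : ln (1 / (2 * q)) <= ln (p / q) by rewrite ler_ln.
have lr0 : 0 <= ln (p / q) := le_trans (ltW ln2q_gt0) lr.
have lx : ln x <= ln astar by rewrite ler_ln ?posrE ?alpha_star_gt0// ltW.
apply: (@le_trans _ _ (ln (p / q) / - ln gamma * (ln abar - ln astar))).
  rewrite ln_alpha_star.
  rewrite [leRHS](_ : _ = ln (p / q) +
      (1 + omega) * ln n%:R * (ln (p / q) / ln (1 / (2 * q)))); last first.
    have lg0 : ln gamma != 0 by rewrite -oppr_eq0 gt_eqF.
    have l20 : ln (1 / (2 * q)) != 0 by rewrite gt_eqF.
    by field; rewrite lg0 l20.
  have o1 : 0 <= 1 + omega by rewrite addr_ge0// ltW.
  rewrite lerD2l; apply: ler_peMr; first exact: mulr_ge0.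
  by rewrite ler_pdivlMr// [leLHS]mul1r.
rewrite ler_wpM2l ?divr_ge0 ?(ltW Nlng_gt0)//; lra.
Qed.

Lemma alpha_star_ge beta : 0 < beta -> (2 <= n)%N -> 1 / 2 <= gamma ->
    (1 / (2 * q)) `^ (ln (2 * beta) / ((1 + omega) * ln n%:R)) <= gamma ->
  beta * abar <= astar.
Proof.
move=> b0 n2 g2 H.
have {}H : ln (2 * beta) / ((1 + omega) * ln n%:R) * ln (1 / (2 * q)) <= ln gamma.
  by rewrite -ln_powR ler_ln ?posrE ?powR_gt0.
have lnn : 0 < ln n%:R :> R by rewrite ln_gt0// ltr1n.
have o1 : 0 < 1 + omega by rewrite addr_gt0.
(* The factor [2] offsets [gamma >= 1 / 2]. In logarithms this is the second lower bound on [gamma],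
   multiplied out using [ln n > 0]. *)
suff H2 : 2 * beta <= n%:R `^ (- ((1 + omega) *
    logb (1 / (2 * q)) (1 / gamma))).
  have -> : beta * abar = abar * (1 / 2) * (2 * beta) by field.
  rewrite /astar /alpha_star ler_pM ?mulr_ge0 ?(ltW abar_gt0) ?(ltW b0)//.
  by rewrite ler_pM2l.
rewrite -ler_ln ?posrE ?mulr_gt0 ?powR_gt0// ln_powR /logb div1r lnV ?posrE//.
move: H; rewrite mulrAC ler_pdivrMr ?mulr_gt0// -ler_pdivlMr// => H.
rewrite (le_trans H)// le_eqVlt; apply/orP; left; apply/eqP.
have l20 : ln (1 / (2 * q)) != 0 by rewrite gt_eqF.
by field.
Qed.

End alpha_star.

(** * Assembly of the complexity bound *)

Theorem theorem3 (R : realType) (m : nat)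
    (cl : objective_class) (phi : 'rV[R]_m -> R) (hphi : in_class cl phi)
    (d : measure_display) (Omega : measurableType d) (P : probability Omega R)
    (gamma alpha_max alpha0 : R) (x0 : 'rV[R]_m)
    (hgamma : 0 < gamma < 1) (halpha_max : 0 < alpha_max)
    (halpha0 : 0 < alpha0 <= alpha_max)
    (F : nat -> set (set Omega))
    (trial : nat -> Omega -> 'rV[R]_m) (success : nat -> set Omega)
    (X : nat -> Omega -> 'rV[R]_m) (A : nat -> Omega -> R)
    (hrun : adaptive_run gamma alpha_max alpha0 x0 F trial success X A)
    (eps : R) (heps : 0 < eps)
    (hT : stopping_time F (stopping_of cl phi eps X))
    (alpha_bar p : R) (halpha_bar : 0 < alpha_bar) (hp : 1 / 2 < p < 1)
    (hconv : alpha_bar <= alpha0)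
    (hrule : step_size_rule gamma alpha_max A)
    (hdrift :
      step_size_drift P F gamma alpha_bar p (stopping_of cl phi eps X) A)
    (oc : R -> R) (hoc0 : forall a : R, 0 < a -> 0 <= oc a)
    (hoc : forall a b : R, 0 < a -> a <= b -> oc b <= oc a)
    (omega : R) (homega : 0 < omega) (n : nat) (hn : (0 < n)%N) :
  let T := stopping_of cl phi eps X in
  let q := 1 - p in
  let c := 2 * Num.sqrt (p * q) / (1 - 2 * Num.sqrt (p * q)) ^+ 2 in
  let astar := alpha_star gamma alpha_bar q omega n in
  let prob_bound := (1 - P [set w | lt_time n (T w)]
                     - (n%:R `^ (- omega))%:E
                     - (c * n%:R `^ (- (1 + omega)))%:E)%E in
  (prob_bound <= P [set w | (TOC_at oc A T w <= (n%:R * oc astar)%:E)%E])%E /\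
  forall beta : R, 0 < beta < 1 / 2 -> (2 <= n)%N ->
    Num.max (1 / 2)
      ((1 / (2 * q)) `^ (ln (2 * beta) / ((1 + omega) * ln n%:R))) <= gamma ->
    beta * alpha_bar <= astar /\
    (prob_bound <=
       P [set w | (TOC_at oc A T w <= (n%:R * oc (beta * alpha_bar))%:E)%E])%E.
Proof.
move=> T q c astar prob_bound.
have [filtF _ _ _ adA _ A0E A_gt0 _ _] := hrun.
have [p_gt12 p_lt1] := andP hp.
have q_gt0 : 0 < q by rewrite subr_gt0.
have amax : alpha_bar <= alpha_max by case/andP: halpha0 => _; exact: le_trans.
have abarA0 w : alpha_bar <= A 0 w by rewrite A0E.
have astar_gt0 : 0 < astar by exact: alpha_star_gt0.
have astarA0 w : astar <= A 0 w.
  by rewrite (le_trans _ (abarA0 w))//; exact: alpha_star_le.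
pose bad := \big[setU/set0]_(i < n) first_below T A astar i.
have mbad : measurable bad.
  by apply: bigsetU_measurable => i _; exact: (measurable_first_below _ filtF adA hT).
have nR_gt0 : 0 < n%:R :> R by rewrite ltr0n.
have Pbad : (P bad <= (n%:R `^ (- omega))%:E)%E.
  have a_gt0 : 0 < p / q * n%:R `^ (1 + omega).
    by rewrite mulr_gt0 ?powR_gt0// divr_gt0//; lra.
  have := measure_first_below_le filtF adA A_gt0 hT hrule hdrift hgamma hp
    halpha_bar amax abarA0 n a_gt0 astarA0.
  move=> /(_ (barrier_alpha_star hgamma halpha_bar hp homega hn))/le_trans; apply.
  rewrite lee_fin ler_pdivrMr// mulrCA -powRD; last first.
    by apply/implyP => _; rewrite gt_eqF.
  rewrite addrCA addNr addr0 powRr1 ?(ltW nR_gt0)//.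
  have n1 : 1 <= n%:R :> R by rewrite ler1n.
  (* With [r = p / q] the claim is [1 + n (r - 1) <= r n], that is [1 <= n]. *)
  by rewrite -/q mulrBr mulr1 (mulrC (p / q)); lra.
have c_ge0 : 0 <= c by rewrite divr_ge0// ?sqr_ge0// mulr_ge0// sqrtr_ge0.
have mlt := measurable_lt_time filtF hT n.
(* A general [y] serves both conclusions: [oc astar] itself, and [oc (beta * alpha_bar)], which is
   at least as large by monotonicity. *)
have cost_le y : oc astar <= y ->
    (prob_bound <= P [set w | (TOC_at oc A T w <= (n%:R * y)%:E)%E])%E.
  move=> ocy; have y0 : 0 <= y := le_trans (hoc0 _ astar_gt0) ocy.
  have mgood := measurable_TOC_at_le filtF adA A_gt0 hT hoc0 hoc
    (mulr_ge0 (ltW nR_gt0) y0).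
  have mU : measurable ([set w | lt_time n (T w)] `|` bad) by exact: measurableU.
  apply: (@le_trans _ _ (1 - P ([set w | lt_time n (T w)] `|` bad))%E); last first.
    rewrite -probability_setC//; apply: le_measure; rewrite ?inE//.
      exact: measurableC.
    (* Off both events the run stops by time [n] and every step size up to then is at least
       [astar]. *)
    move=> w /= /not_orP[/negP Tn nbad].
    case Tw: (T w) Tn => [t|//] /=; rewrite -leqNgt => tn.
    apply: (TOC_at_le hoc0 hoc Tw tn astar_gt0 _ ocy).
    exact: above_of_not_first_below nbad.
  have PU : (P ([set w | lt_time n (T w)] `|` bad) <=
      P [set w | lt_time n (T w)] + P bad)%E by exact: measureU2.
  have cn : 0 <= c * n%:R `^ (- (1 + omega)) by rewrite mulr_ge0// powR_ge0.
  move: PU Pbad; rewrite /prob_bound.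
  rewrite -(fineK (fin_num_measure P _ mlt)) -(fineK (fin_num_measure P _ mbad)).
  rewrite -(fineK (fin_num_measure P _ mU)).
  by rewrite -!EFinB -EFinD !lee_fin; lra.
split; first exact: cost_le.
move=> beta /andP[b0 _] n2; rewrite ge_max => /andP[g2 gb].
have ba : beta * alpha_bar <= astar by exact: alpha_star_ge.
by split => //; apply/cost_le/hoc => //; exact: mulr_gt0.
Qed.
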